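(* Let $n\ge 2$ and let $\pi,\sigma\in\mathfrak{B}_n$ have respective length vectors $(\ell_1,\ell_2,\ell_3,\ell_4)$ and $(m_1,m_2,m_3,m_4)$. Then the distance between $\pi$ and $\sigma$ in the Hasse diagram of $(\mathfrak{B}_n,\le)$ is $$\max\{|\ell_1-m_1|+|\ell_4-m_4|,\ |\ell_2-m_2|+|\ell_3-m_3|\}.$$ In particular, the Hasse diagram of $\mathfrak{B}_n$ is connected.
   Context: $\mathfrak{S}_n$ is the set of permutations of $[n]=\{1,\dots,n\}$, in one-line notation. A reduction of $\omega\in\mathfrak{S}_n$ interchanges $\omega(i)$ and $\omega(j)$ for some $i<j$ with $\omega(i)>\omega(j)$. Bruhat order: $\pi\le\sigma$ if $\pi$ is obtained from $\sigma$ by a (possibly empty) sequence of reductions. $\mathfrak{B}_n\subseteq\mathfrak{S}_n$ is the set of bigrassmannian permutations (both $\omega$ and $\omega^{-1}$ have exactly one descent), with the order inherited from Bruhat order; equivalently $\omega=1\cdots a\,(b+1)\cdots c\,(a+1)\cdots b\,(c+1)\cdots n$ for a unique triple $0\le a<b<c\le n$. The length vector of such an element is $(\ell_1,\ell_2,\ell_3,\ell_4)=(a+1,b-a,c-b,n+1-c)$. The Hasse diagram is the undirected graph on $\mathfrak{B}_n$ whose edges join pairs in which one element covers the other in the poset $(\mathfrak{B}_n,\le)$; distance is the number of edges in a shortest walk. *)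

(* Defs.v *)
From mathcomp Require Import all_boot all_order all_fingroup.
From mathcomp Require Import ssrint.

Set Implicit Arguments.
Unset Strict Implicit.
Unset Printing Implicit Defensive.

Local Open Scope nat_scope.

Section Bigrassmannian.

Variable n : nat.
Implicit Types (v w : 'S_n) (a b c : nat).

(* A position i of the one-line notation is the ordinal i - 1, and likewise for
   values. *)

(* The product in 'S_n applies its left factor first, so (tperm i j * w)%g is w
   with the values at positions i and j interchanged. *)
Definition reduction w v : bool :=
  [exists i : 'I_n, exists j : 'I_n,
    [&& i < j, w j < w i & v == (tperm i j * w)%g]].

Definition bruhat_le v w : bool := connect reduction w v.

Definition descents w : {set 'I_n} :=
  [set i : 'I_n | [exists j : 'I_n, (j == i.+1 :> nat) && (w j < w i)]].

Definition bigrassmannian w : bool :=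
  (#|descents w| == 1) && (#|descents w^-1%g| == 1).

Definition bigrass : Type := {w : 'S_n | bigrassmannian w}.

(* The shift by 1 makes the values range over 1, ..., n. *)
Definition one_line w : seq nat := [seq (w i).+1 | i <- enum 'I_n].

(* 1 ... a (b+1) ... c (a+1) ... b (c+1) ... n *)
Definition block_word a b c : seq nat :=
  iota 1 a ++ iota b.+1 (c - b) ++ iota a.+1 (b - a) ++ iota c.+1 (n - c).

Definition is_block_triple w (t : 'I_n.+1 * 'I_n.+1 * 'I_n.+1) : bool :=
  let: (a, b, c) := t in
  [&& a < b, b < c & one_line w == block_word a b c].

(* The default value is never reached on bigrassmannian permutations. *)
Definition length_vector (p : bigrass) : nat * nat * nat * nat :=
  if [pick t | is_block_triple (val p) t] is Some (a, b, c)
  then (a.+1, b - a, c - b, n.+1 - c)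
  else (0, 0, 0, 0).

Definition bigrass_lt (p q : bigrass) : bool :=
  (p != q) && bruhat_le (val p) (val q).

Definition bigrass_covers (q p : bigrass) : bool :=
  bigrass_lt p q && ~~ [exists r : bigrass, bigrass_lt p r && bigrass_lt r q].

Definition hasse : rel bigrass :=
  fun p q => bigrass_covers p q || bigrass_covers q p.

End Bigrassmannian.

Section GraphDistance.

Variables (T : finType) (e : rel T).

Definition has_walk (x y : T) (k : nat) : Prop :=
  exists s : seq T, [/\ path e x s, last x s = y & size s = k].

(* In particular y is reachable from x. *)
Definition is_distance (x y : T) (d : nat) : Prop :=
  has_walk x y d /\ forall k, has_walk x y k -> d <= k.

Definition connected_graph : Prop :=
  0 < #|T| /\ forall x y : T, connect e x y.

End GraphDistance.

(* Main.v *)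
(** In terms of length vectors, Bruhat order on bigrassmannian permutations is
    the componentwise order in which the outer lengths l1, l4 decrease and the
    inner lengths l2, l3 increase. Necessity comes from four statistics that are
    monotone under reductions: the fixed prefix, the fixed suffix, and the
    largest displacements to the left and to the right. For sufficiency, moving
    one unit of length from an inner to an outer component is a slide of a single
    value past a block of larger (or smaller) ones, up to inversion. As the sum of
    the lengths is constant, covers are exactly these unit moves. A walk thus
    changes each of |l1 - m1| + |l4 - m4| and |l2 - m2| + |l3 - m3| by at most one
    per step, and a greedy choice of the unit move always decreases their
    maximum. *)

Require Import Defs.
From mathcomp Require Import all_boot all_order all_fingroup.
From mathcomp Require Import ssrint zify.

Set Implicit Arguments.
Unset Strict Implicit.
Unset Printing Implicit Defensive.

Local Open Scope nat_scope.

Ltac case_lia :=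
  repeat match goal with
  | |- context [if ?b then _ else _] =>
      lazymatch b with
      | context [if _ then _ else _] => fail
      | _ => case: (boolP b) => ?
      end
  end; lia.

(* The one-line notation of block_word a b c, 0-indexed. *)
Definition block_fun a b c i :=
  if i < a then i else if i < a + (c - b) then b + (i - a)
  else if i < c then i - (c - b) else i.

(** Inversion exchanges the lengths of the two inner blocks, which moves the middle cut from [b] to
    [a + (c - b)]. *)
Lemma block_funK a b c : a < b -> b < c ->
  cancel (block_fun a b c) (block_fun a (a + (c - b)) c).
Proof. by move=> ab bc i; rewrite /block_fun; case_lia. Qed.

(** * Functions with at most one descent *)

Section AscentsExceptOne.

Variables (f : nat -> nat) (D : nat).
Hypothesis asc_f : forall i, i.+1 != D -> f i < f i.+1.

Lemma ascending_lt i j : i < j -> (j < D) || (D <= i) -> f i < f j.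
Proof.
elim: j => // j IH; rewrite ltnS leq_eqVlt => /predU1P[->|ij] jD.
  by apply: asc_f; lia.
by apply: ltn_trans (IH ij _) (asc_f _); lia.
Qed.

Lemma ascending_tail_ge c i : D <= c -> c <= f c -> c <= i -> i <= f i.
Proof.
move=> Dc cf; elim: i => [|i IH]; first by lia.
rewrite leq_eqVlt => /predU1P[<- //|ci].
by apply: leq_ltn_trans (IH ci) (asc_f _); lia.
Qed.

End AscentsExceptOne.

(* With D and b the descents of a permutation f and of its inverse g, the first
   point a moved by f satisfies f a = b and g a = D. *)
Lemma ascending_run f g D b a :
  cancel f g -> cancel g f ->
  (forall i, i.+1 != D -> f i < f i.+1) ->
  (forall i, i.+1 != b -> g i < g i.+1) ->
  (forall i, i < a -> f i = i) -> f a != a ->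
  a < D /\ forall i, a <= i -> i < D -> f i = b + (i - a).
Proof.
move=> fK gK asc_f asc_g fix_f fa.
have fix_g i : i < a -> g i = i by move=> ia; rewrite -{1}(fix_f i ia) fK.
have lt_fa : a < f a.
  rewrite ltn_neqAle eq_sym fa leqNgt; apply/negP => lt_a.
  by have := fix_g _ lt_a; rewrite fK; lia.
have lt_ga : a < g a.
  rewrite ltn_neqAle leqNgt; apply/andP; split.
    by apply: contra fa => /eqP {1}->; rewrite gK.
  by apply/negP => lt_a; have := fix_f _ lt_a; rewrite gK; lia.
(* If [D <= a], then [f] ascends from [a] to [g a], so [f a < f (g a) = a]. The next two bounds come
   from [g] likewise. *)
have aD : a < D.
  rewrite ltnNge; apply/negP => Da.
  by have := ascending_lt asc_f lt_ga; rewrite gK; lia.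
have ab : a < b.
  rewrite ltnNge; apply/negP => ba.
  by have := ascending_lt asc_g lt_fa; rewrite fK; lia.
have b_fa : b <= f a.
  rewrite leqNgt; apply/negP => lt_b.
  by have := ascending_lt asc_g lt_fa; rewrite fK; lia.
(* If [b < f a], then [g b < a], so [f] fixes [g b], which therefore equals [b > a]. *)
have fa_b : f a = b.
  apply/eqP; rewrite eqn_leq b_fa andbT leqNgt; apply/negP => lt_b.
  have := ascending_lt asc_g lt_b; rewrite fK leqnn orbT => /(_ isT) lt_a.
  by have := fix_f _ lt_a; rewrite gK; lia.
split=> // i; elim: i => [|i IH] ai iD.
  by rewrite -fa_b (_ : a = 0) ?addn0 //; lia.
case: (ltnP i a) => [ia|ia]; first by rewrite -fa_b (_ : i.+1 = a) ?subnn ?addn0 //; lia.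
have fi := IH ia (ltnW iD); have fi1 : f i < f i.+1 by apply: asc_f; lia.
case: (ltnP (f i).+1 (f i.+1)) => [gap|]; last by lia.
(* A skipped value would have its position strictly between i and i + 1. *)
have := ascending_lt asc_g (ltnSn (f i)); have := ascending_lt asc_g gap.
by rewrite !fK; lia.
Qed.

(** * Permutations extended to the natural numbers *)

Section Extension.

Variable n : nat.
Implicit Types (u v w : 'S_n) (i j p q : nat).

(* The one-line notation as a function on nat, 0-indexed and extended by the
   identity. *)
Definition ext w i : nat := if insub i is Some o then w o else i.

Lemma ext_ord w (o : 'I_n) : ext w o = w o.
Proof. by rewrite /ext valK. Qed.

Lemma ext_ge w i : n <= i -> ext w i = i.
Proof. by move=> ni; rewrite /ext insubF // ltnNge ni. Qed.

Lemma ext_lt w i : (ext w i < n) = (i < n).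
Proof.
case: (ltnP i n) => [lt_in|le_ni]; last by rewrite ext_ge // ltnNge le_ni.
by rewrite -[i]/(val (Ordinal lt_in)) ext_ord ltn_ord.
Qed.

Lemma extK w : cancel (ext w) (ext w^-1%g).
Proof.
move=> i; case: (ltnP i n) => [lt_in|le_ni]; last by rewrite !ext_ge.
by rewrite -[i]/(val (Ordinal lt_in)) !ext_ord permK.
Qed.

Lemma extKV w : cancel (ext w^-1%g) (ext w).
Proof. by move=> i; have := extK w^-1%g i; rewrite invgK. Qed.

Lemma ext_inj u w : (forall i, i < n -> ext u i = ext w i) -> u = w.
Proof. by move=> uw; apply/permP => o; apply/val_inj; rewrite /= -!ext_ord uw. Qed.

Definition swap i j k := if k == i then j else if k == j then i else k.

Lemma ext_tperm (o o' : 'I_n) w i :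
  ext (tperm o o' * w)%g i = ext w (swap o o' i).
Proof.
rewrite /swap; case: (ltnP i n) => [lt_in|le_ni]; last first.
  rewrite !ifN ?ext_ge //; apply/eqP; have := ltn_ord o; have := ltn_ord o'; lia.
rewrite -[i]/(nat_of_ord (Ordinal lt_in)) ext_ord permM.
move: (Ordinal lt_in) => x; rewrite !val_eqE.
case: tpermP => [->|->|/eqP no /eqP no']; rewrite ?eqxx ?ext_ord //.
  by case: eqP => [->|]; rewrite ext_ord.
by rewrite (negbTE no) (negbTE no') ext_ord.
Qed.

(** * Reductions, inversion and slides *)

Lemma reductionP w v :
  reflect (exists i j, [/\ i < j, j < n, ext w j < ext w i
                         & forall k, ext v k = ext w (swap i j k)])
          (reduction w v).
Proof.
apply: (iffP existsP) => [[o /existsP[o' /and3P[oo' lt_w /eqP ->]]]|].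
  exists o, o'; split; rewrite ?ext_ord ?ltn_ord // => k; exact: ext_tperm.
move=> [i [j [ij jn lt_w vE]]].
exists (Ordinal (ltn_trans ij jn)); apply/existsP; exists (Ordinal jn).
rewrite -!ext_ord ij lt_w /=; apply/eqP/ext_inj => k _.
by rewrite ext_tperm vE.
Qed.

Lemma bruhat_ind (P : (nat -> nat) -> Prop) :
  (forall f g i j, i < j -> j < n -> f j < f i -> injective f ->
     (forall k, g k = f (swap i j k)) -> P f -> P g) ->
  forall v w, bruhat_le v w -> P (ext w) -> P (ext v).
Proof.
move=> step v w /connectP[s]; elim: s w => [|x s IH] w /=; first by move=> _ ->.
move=> /andP[/reductionP[i [j [ij jn lt_w xE]]] xs] vE Pw.
apply: (IH x xs vE); apply: (step (ext w) _ i j) => //.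
exact: can_inj (extK w).
Qed.

(** Exchanging positions [o < o'] of [w] exchanges positions [w o' < w o] of the inverse, whose
    values [o' > o] are again out of order. *)
Lemma bruhat_le_inv v w : bruhat_le v w -> bruhat_le v^-1%g w^-1%g.
Proof.
move=> /connectP[s]; elim: s w => [|x s IH] w /=.
  by move=> _ ->; apply: connect0.
move=> /andP[/existsP[o /existsP[o' /and3P[oo' lt_w /eqP xE]]] xs] vE.
apply: connect_trans (IH x xs vE); apply: connect1.
apply/existsP; exists (w o'); apply/existsP; exists (w o).
rewrite lt_w !permK oo' xE /= invMg tpermV tpermC.
by rewrite -tpermJ conjgE !mulgA mulgK eqxx.
Qed.

(** The value at position [p + k] moves to [p] by adjacent exchanges, each a reduction because it
    passes a larger value. *)
Lemma bruhat_le_slide_left k p u w :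
  p + k < n -> (forall i, p <= i -> i < p + k -> ext w (p + k) < ext w i) ->
  (forall i, ext u i =
     ext w (if i == p then p + k else if p < i <= p + k then i.-1 else i)) ->
  bruhat_le u w.
Proof.
elim: k w => [|k IH] w; rewrite ?addn0 ?addnS => lt_n big uE.
  suff -> : u = w by apply: connect0.
  by apply: ext_inj => i _; rewrite uE; congr ext; case_lia.
pose v := (tperm (Ordinal (ltnW lt_n)) (Ordinal lt_n) * w)%g.
have vE i : ext v i = ext w (swap (p + k) (p + k).+1 i) by apply: ext_tperm.
have wv : reduction w v.
  by apply/reductionP; exists (p + k), (p + k).+1; split=> //; apply: big; lia.
apply: connect_trans (connect1 wv) _; apply: IH; first lia.
  move=> i pi ik; rewrite !vE /swap eqxx !ifN; [apply: big|apply/eqP|apply/eqP]; lia.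
by move=> i; rewrite uE vE; congr ext; rewrite /swap; case_lia.
Qed.

Lemma bruhat_le_slide_right k p u w :
  p + k < n -> (forall i, p < i -> i <= p + k -> ext w i < ext w p) ->
  (forall i, ext u i =
     ext w (if i == p + k then p else if p <= i < p + k then i.+1 else i)) ->
  bruhat_le u w.
Proof.
elim: k p w => [|k IH] p w; rewrite ?addn0 => lt_n small uE.
  suff -> : u = w by apply: connect0.
  by apply: ext_inj => i _; rewrite uE; congr ext; case_lia.
have pn : p < n by lia.
have pn1 : p.+1 < n by lia.
pose v := (tperm (Ordinal pn) (Ordinal pn1) * w)%g.
have vE i : ext v i = ext w (swap p p.+1 i) by apply: ext_tperm.
have wv : reduction w v.
  by apply/reductionP; exists p, p.+1; split=> //; apply: small; lia.
apply: connect_trans (connect1 wv) _; apply: (IH p.+1); first lia.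
  move=> i pi ik; have -> : ext v p.+1 = ext w p by rewrite vE /swap; congr ext; case_lia.
  rewrite vE (_ : swap _ _ _ = i); [apply: small|rewrite /swap]; case_lia.
by move=> i; rewrite uE vE; congr ext; rewrite /swap; case_lia.
Qed.

(** * Bruhat comparison of block permutations *)

Definition block_perm w a b c :=
  [/\ a < b, b < c, c <= n & forall i, ext w i = block_fun a b c i].

Lemma block_perm_exists a b c :
  a < b -> b < c -> c <= n -> exists w, block_perm w a b c.
Proof.
move=> ab bc cn.
have lt_n (o : 'I_n) : block_fun a b c o < n.
  by have := ltn_ord o; rewrite /block_fun; case_lia.
have inj : injective (fun o => Ordinal (lt_n o)).
  by move=> o o' [] /(can_inj (block_funK ab bc))/val_inj.
exists (perm inj); split=> // i; case: (ltnP i n) => [lt_in|le_ni].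
  by rewrite -[i]/(val (Ordinal lt_in)) ext_ord permE.
by rewrite ext_ge // /block_fun; case_lia.
Qed.

Lemma block_perm_inv w a b c :
  block_perm w a b c -> block_perm w^-1%g a (a + (c - b)) c.
Proof.
move=> [ab bc cn wE]; split; try lia.
by move=> i; rewrite -{2}(extKV w i) wE block_funK.
Qed.

Lemma block_perm_fun_inj u w a b c :
  block_perm u a b c -> block_perm w a b c -> u = w.
Proof. by move=> [_ _ _ uE] [_ _ _ wE]; apply: ext_inj => i _; rewrite uE wE. Qed.

(* A reduction keeps fixed prefixes and suffixes, and increases neither the
   largest left displacement nor the largest right displacement. *)
Lemma bruhat_le_block u w a' b' c' a b c :
  block_perm u a' b' c' -> block_perm w a b c -> bruhat_le u w ->
  [/\ a <= a', c' <= c, c' - b' <= c - b & b' - a' <= b - a].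
Proof.
move=> [ab' bc' cn' uE] [ab bc cn wE] uw; split.
- have fixp i : i < a -> ext u i = i.
    move: i; pattern (ext u); apply: bruhat_ind uw _ => [f g i j ij jn fij finj gE fP k ka|i ia].
      (* An exchange at [i < a] needs [f j < f i = i]; then [f j] is a fixed point, and injectivity
         gives [f j = j > i]. *)
      rewrite gE /swap; have ai : a <= i.
        rewrite leqNgt; apply/negP => ia; have fi := fP i ia.
        have /finj : f (f j) = f j by apply: fP; lia.
        lia.
      by rewrite !ifN ?fP //; apply/eqP; lia.
    by rewrite wE /block_fun ia.
  (* The first position moved by [u] is [a'], the last [c'.-1]; these also attain its largest right
     and left displacements. *)
  rewrite leqNgt; apply/negP => /fixp; rewrite uE /block_fun; case_lia.
- have fixp i : c <= i -> ext u i = i.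
    move: i; pattern (ext u); apply: bruhat_ind uw _ => [f g i j ij jn fij finj gE fP k ka|i ia].
      rewrite gE /swap; have ai : j < c.
        rewrite ltnNge; apply/negP => ia; have fj := fP j ia.
        have /finj : f (f i) = f i by apply: fP; lia.
        lia.
      by rewrite !ifN ?fP //; apply/eqP; lia.
    by rewrite wE /block_fun; case_lia.
  rewrite leqNgt; apply/negP => lt_c; have := fixp c'.-1; rewrite uE /block_fun; case_lia.
(* After exchanging [i < j], both left displacements are at most the old one at [j], and both right
   ones at most the old one at [i]. *)
- have disp i : i <= ext u i + (c - b).
    move: i; pattern (ext u); apply: bruhat_ind uw _ => [f g i j ij jn fij finj gE fP k|i].
      rewrite gE /swap; have := fP k; have := fP i; have := fP j.
      by case: eqP => [->|_]; [lia|case: eqP => [->|_]; lia].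
    by rewrite wE /block_fun; case_lia.
  by have := disp c'.-1; rewrite uE /block_fun; case_lia.
- have disp i : ext u i <= i + (b - a).
    move: i; pattern (ext u); apply: bruhat_ind uw _ => [f g i j ij jn fij finj gE fP k|i].
      rewrite gE /swap; have := fP k; have := fP i; have := fP j.
      by case: eqP => [->|_]; [lia|case: eqP => [->|_]; lia].
    by rewrite wE /block_fun; case_lia.
  by have := disp a'; rewrite uE /block_fun; case_lia.
Qed.

Lemma block_perm_inj w a b c a' b' c' :
  block_perm w a b c -> block_perm w a' b' c' -> [/\ a = a', b = b' & c = c'].
Proof.
move=> w1 w2; have le_w : bruhat_le w w by apply: connect0.
have [] := bruhat_le_block w1 w2 le_w; have [] := bruhat_le_block w2 w1 le_w.
case: w1 w2 => [? ? _ _] [? ? _ _] *; split; lia.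
Qed.

(** In [w] the value [a] stands just after the larger values [b, ..., c - 1]; sliding it in front of
    them fixes it. *)
Lemma bruhat_le_fix_left u w a b c :
  block_perm u a.+1 b c -> block_perm w a b c -> bruhat_le u w.
Proof.
move=> [ab' _ _ uE] [ab bc cn wE].
apply: (@bruhat_le_slide_left (c - b) a); first lia.
  by move=> i ai ic; rewrite !wE /block_fun; case_lia.
by move=> i; rewrite uE wE /block_fun; case_lia.
Qed.

(** In [w] the value [c] stands just before the smaller values [a, ..., b - 1]; sliding it behind
    them fixes it. *)
Lemma bruhat_le_fix_right u w a b c :
  block_perm u a b c -> block_perm w a b c.+1 -> bruhat_le u w.
Proof.
move=> [_ bc' _ uE] [ab bc cn wE].
apply: (@bruhat_le_slide_right (b - a) (a + (c - b))); first lia.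
  by move=> i ai ic; rewrite !wE /block_fun; case_lia.
by move=> i; rewrite uE wE /block_fun; case_lia.
Qed.

Lemma bruhat_le_fix_left_inv u w a b c :
  block_perm u a.+1 b.+1 c -> block_perm w a b c -> bruhat_le u w.
Proof.
move=> u_blk w_blk; rewrite -[u]invgK -[w]invgK; apply: bruhat_le_inv.
have [_ bc' _ _] := u_blk; have [_ bc _ _] := w_blk.
apply: bruhat_le_fix_left (block_perm_inv w_blk).
by have := block_perm_inv u_blk; rewrite (_ : _ + _ = a + (c - b)) //; lia.
Qed.

Lemma bruhat_le_fix_right_inv u w a b c :
  block_perm u a b c -> block_perm w a b.+1 c.+1 -> bruhat_le u w.
Proof.
move=> u_blk w_blk; rewrite -[u]invgK -[w]invgK; apply: bruhat_le_inv.
exact: bruhat_le_fix_right (block_perm_inv u_blk) (block_perm_inv w_blk).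
Qed.

(** The lengths have constant sum, so if an outer length of [w] is below the target, an inner one is
    above it. Moving one unit between these two stays above the target. *)
Lemma bruhat_le_block_step a' b' c' w a b c :
  a' < b' -> b' < c' -> block_perm w a b c ->
  a <= a' -> c' <= c -> c' - b' <= c - b -> b' - a' <= b - a ->
  0 < (a' - a) + (c - c') ->
  exists w1 a1 b1 c1,
    [/\ block_perm w1 a1 b1 c1, bruhat_le w1 w,
        [/\ a <= a1, c1 <= c & (a1 - a) + (c - c1) = 1]
      & [/\ a1 <= a', c' <= c1, c' - b' <= c1 - b1 & b' - a' <= b1 - a1]].
Proof.
move=> ab' bc' w_blk aa cc cb ba gap; have [ab bc cn _] := w_blk.
case: (ltnP a a') => [lt_a|le_a].
  case: (ltnP (b' - a') (b - a)) => [lt_ba|le_ba].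
    have [|||w1 w1_blk] := @block_perm_exists a.+1 b c; try lia.
    exists w1, a.+1, b, c; split=> //; last (split; lia); last (split; lia).
    exact: bruhat_le_fix_left w1_blk w_blk.
  have [|||w1 w1_blk] := @block_perm_exists a.+1 b.+1 c; try lia.
  exists w1, a.+1, b.+1, c; split=> //; last (split; lia); last (split; lia).
  exact: bruhat_le_fix_left_inv w1_blk w_blk.
case: c w_blk cc cb gap bc cn => [|c] w_blk cc cb gap bc cn; first lia.
case: (ltnP (b' - a') (b - a)) => [lt_ba|le_ba]; last first.
  have [|||w1 w1_blk] := @block_perm_exists a b c; try lia.
  exists w1, a, b, c; split=> //; last (split; lia); last (split; lia).
  exact: bruhat_le_fix_right w1_blk w_blk.
case: b w_blk ab bc cb ba lt_ba => [|b] w_blk ab bc cb ba lt_ba; first lia.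
have [|||w1 w1_blk] := @block_perm_exists a b c; try lia.
exists w1, a, b, c; split=> //; last (split; lia); last (split; lia).
exact: bruhat_le_fix_right_inv w1_blk w_blk.
Qed.

Lemma block_bruhat_le u w a' b' c' a b c :
  block_perm u a' b' c' -> block_perm w a b c ->
  a <= a' -> c' <= c -> c' - b' <= c - b -> b' - a' <= b - a -> bruhat_le u w.
Proof.
move=> u_blk; have [ab' bc' _ _] := u_blk.
(* This counts the unit moves still to be made. *)
have [m] := ubnP ((a' - a) + (c - c')).
elim: m w a b c => [|m IH] w a b c; first lia.
move=> lt_m w_blk aa cc cb ba.
have [ab bc _ _] := w_blk.
case: (posnP ((a' - a) + (c - c'))) => [eq0|gap].
  have [eq_a eq_b eq_c] : [/\ a' = a, b' = b & c' = c] by split; lia.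
  rewrite eq_a eq_b eq_c in u_blk.
  by rewrite (block_perm_fun_inj u_blk w_blk); apply: connect0.
have [w1 [a1 [b1 [c1 [blk1 le1 [? ? ?] [? ? ? ?]]]]]] :=
  bruhat_le_block_step ab' bc' w_blk aa cc cb ba gap.
by apply: connect_trans le1 _; apply: (IH w1 a1 b1 c1) => //; lia.
Qed.

(** * Bigrassmannian permutations are block permutations *)

Lemma mem_descents w (o : 'I_n) : (o \in descents w) = (ext w o.+1 < ext w o).
Proof.
rewrite inE; apply/existsP/idP => [[o' /andP[/eqP <-]]|lt_w].
  by rewrite !ext_ord.
have lt_n : o.+1 < n by rewrite -(ext_lt w); apply: leq_trans lt_w _; rewrite ltnW ?ext_lt.
by exists (Ordinal lt_n); rewrite eqxx -!ext_ord.
Qed.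

(** [D] is the position just after the descent, the form that the lemmas on ascents expect. *)
Lemma one_descentP w :
  reflect (exists2 D, ext w D < ext w D.-1
             & forall i, i.+1 != D -> ext w i < ext w i.+1)
          (#|descents w| == 1).
Proof.
apply: (iffP cards1P) => [[o oE]|[D lt_w asc]].
  exists o.+1; first by rewrite -mem_descents oE inE.
  move=> i; rewrite eqSS => io; case: (ltnP i n) => [lt_in|le_ni]; last first.
    by rewrite !ext_ge //; lia.
  have : Ordinal lt_in \notin descents w by rewrite oE inE -val_eqE.
  rewrite mem_descents /= -leqNgt leq_eqVlt.
  by rewrite (inj_eq (can_inj (extK w))) ltn_eqF.
have D0 : 0 < D by rewrite lt0n; apply: contraTneq lt_w => ->; rewrite ltnn.
have lt_n : D.-1 < n.
  by case: (ltnP D.-1 n) lt_w => // le_n; rewrite !ext_ge //; lia.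
exists (Ordinal lt_n); apply/setP => o; rewrite mem_descents inE -val_eqE /=.
case: eqP => [->|ne]; first by rewrite prednK // lt_w.
by apply/negbTE; rewrite -leqNgt ltnW // asc //; apply/eqP; lia.
Qed.

Lemma block_perm_one_descent w a b c : block_perm w a b c -> #|descents w| == 1.
Proof.
move=> [ab bc cn wE]; apply/one_descentP; exists (a + (c - b)).
  by rewrite !wE /block_fun; case_lia.
by move=> i; rewrite !wE /block_fun; case_lia.
Qed.

Lemma block_perm_bigrassmannian w a b c : block_perm w a b c -> bigrassmannian w.
Proof.
move=> w_blk; rewrite /bigrassmannian (block_perm_one_descent w_blk).
exact: block_perm_one_descent (block_perm_inv w_blk).
Qed.

Lemma bigrassmannian_block_perm w :
  bigrassmannian w -> exists a b c, block_perm w a b c.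
Proof.
move=> /andP[/one_descentP[D desc_w asc_w] /one_descentP[b desc_v asc_v]].
pose f := ext w; pose g := ext w^-1%g.
have fK : cancel f g by apply: extK.
have gK : cancel g f by apply: extKV.
have moved : exists i, f i != i.
  have [fD|] := eqVneq (f D) D; last by exists D.
  have [fD1|] := eqVneq (f D.-1) D.-1; last by exists D.-1.
  by move: desc_w; rewrite -/f fD fD1; lia.
have [a fa a_min] := ex_minnP moved.
have fix_f i : i < a -> f i = i.
  by move=> ia; apply/eqP; apply: contraLR ia => /a_min; rewrite -leqNgt.
have fix_g i : i < a -> g i = i by move=> ia; rewrite -{1}(fix_f i ia) fK.
have ga : g a != a by apply: contra fa => /eqP {1}<-; rewrite gK.
have [aD run_f] := ascending_run fK gK asc_w asc_v fix_f fa.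
have [ab run_g] := ascending_run gK fK asc_v asc_w fix_g ga.
(* The blocks have [D - a] and [b - a] entries, so both the positions and the values of the moved
   part end at [c]. *)
pose c := D + (b - a).
(* Everything below [c] is used up, so [f] and [g] preserve the range from [c] on. Both increase
   there, whence [i <= f i <= g (f i) = i]. *)
have fix_ge i : c <= i -> f i = i.
  move=> ci; have := ascending_tail_ge asc_w (_ : D <= c) (_ : c <= f c) ci.
  have := ascending_tail_ge asc_v (_ : b <= c) (_ : c <= g c).
  move=> tail_g tail_f.
  have out_f k : c <= k -> c <= f k.
    move=> ck; rewrite leqNgt; apply/negP => lt_c.
    case: (ltnP (f k) a) => [/fix_g|ak]; first by rewrite fK; lia.
    case: (ltnP (f k) b) => [kb|bk].
      by have := run_g _ ak kb; rewrite fK; lia.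
    have := run_f (a + (f k - b)); rewrite (_ : b + _ = f k); last lia.
    move=> /(_ _ _)/(can_inj fK); lia.
  have out_g k : c <= k -> c <= g k.
    move=> ck; rewrite leqNgt; apply/negP => lt_c.
    case: (ltnP (g k) a) => [/fix_f|ak]; first by rewrite gK; lia.
    case: (ltnP (g k) D) => [kb|bk].
      by have := run_f _ ak kb; rewrite gK; lia.
    have := run_g (a + (g k - D)); rewrite (_ : D + _ = g k); last lia.
    move=> /(_ _ _)/(can_inj gK); lia.
  have fi : i <= f i by apply: tail_f; rewrite ?out_f //; lia.
  have gi : f i <= g (f i) by apply: tail_g; rewrite ?out_g //; lia.
  by rewrite fK in gi; lia.
exists a, b, c; split; try lia.
  (* Otherwise position [c - 1 >= n] would be fixed, yet it carries the value [b - 1 < c - 1]. *)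
  rewrite leqNgt; apply/negP => nc.
  have gb : g b.-1 = c.-1 by rewrite run_g; lia.
  by have := gK b.-1; rewrite gb /f ext_ge; lia.
move=> i; rewrite -/(f i) /block_fun.
case: ifP => ia; first exact: fix_f.
case: ifP => iD; first by apply: run_f; lia.
case: ifP => ic; last by apply: fix_ge; lia.
have := run_g (a + (i - D)) (leq_addr _ _).
rewrite (_ : D + _ = i); last lia.
by move=> /(_ _)/(congr1 f); rewrite gK; lia.
Qed.

(** * Block triples and length vectors *)

Lemma is_block_tripleP w (a b c : 'I_n.+1) :
  reflect (block_perm w a b c) (is_block_triple w (a, b, c)).
Proof.
have size_line : size (one_line w) = n by rewrite size_map size_enum_ord.
have nth_line i : i < n -> nth 0 (one_line w) i = (ext w i).+1.
  move=> lt_in; rewrite (nth_map (Ordinal lt_in)) ?size_enum_ord //.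
  by rewrite -ext_ord nth_enum_ord.
have cn := ltn_ord c.
have size_word : a < b -> b < c -> size (block_word n a b c) = n.
  by move=> ab bc; rewrite !size_cat !size_iota; lia.
have nth_word i : a < b -> b < c -> i < n ->
    nth 0 (block_word n a b c) i = (block_fun a b c i).+1.
  move=> ab bc lt_in; rewrite !nth_cat !size_iota /block_fun.
  case: (ltnP i a) => ia; first by rewrite nth_iota; lia.
  have -> : (i - a < c - b) = (i < a + (c - b)) by lia.
  case: (ltnP i (a + (c - b))) => ib; first by rewrite nth_iota; lia.
  have -> : (i - a - (c - b) < b - a) = (i < c) by lia.
  by case: (ltnP i c) => ic; rewrite nth_iota; lia.
apply: (iffP and3P) => [[ab bc /eqP wE]|[ab bc _ wE]]; split=> //.
  move=> i; case: (ltnP i n) => [lt_in|le_ni].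
    by apply/succn_inj; rewrite -nth_line // wE nth_word.
  by rewrite ext_ge // /block_fun; case_lia.
apply/eqP/(@eq_from_nth _ 0); first by rewrite size_line size_word.
by rewrite size_line => i lt_in; rewrite nth_line // nth_word // wE.
Qed.

Lemma length_vectorE (p : bigrass n) a b c :
  block_perm (val p) a b c -> length_vector p = (a.+1, b - a, c - b, n.+1 - c).
Proof.
move=> blk; have [ab bc cn _] := blk; rewrite /length_vector.
have [an bn] : a < n.+1 /\ b < n.+1 by split; lia.
(* Uniqueness of the triple makes the choice of [pick] irrelevant, and existence excludes the
   default. *)
case: pickP => [[[x y] z] /is_block_tripleP|/(_ (Ordinal an, Ordinal bn, Ordinal (cn : c < n.+1)))].
  by move=> /(block_perm_inj blk)[<- <- <-].
by move=> /is_block_tripleP.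
Qed.

(** * Covers *)

Lemma bigrass_block (p : bigrass n) : exists a b c, block_perm (val p) a b c.
Proof. exact: bigrassmannian_block_perm (valP p). Qed.

(** The gap [(a' - a) + (c - c')] adds up along chains and vanishes only for equal elements. A gap
    of at least 2 leaves room for a unit move; a gap of 1 does not. *)
Lemma bigrass_coversP (p q : bigrass n) a' b' c' a b c :
  block_perm (val p) a' b' c' -> block_perm (val q) a b c ->
  reflect ([/\ a <= a', c' <= c & (a' - a) + (c - c') = 1]
             /\ c' - b' <= c - b /\ b' - a' <= b - a)
          (bigrass_covers q p).
Proof.
move=> p_blk q_blk; have [ab' bc' _ _] := p_blk; have [ab bc _ _] := q_blk.
apply: (iffP andP) => [[/andP[pq le_pq] nob]|[[aa cc gap] [cb ba]]].
  have [aa cc cb ba] := bruhat_le_block p_blk q_blk le_pq.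
  have gap : 0 < (a' - a) + (c - c').
    rewrite lt0n; apply: contra pq => /eqP gap.
    have [ea eb ec] : [/\ a' = a, b' = b & c' = c] by split; lia.
    rewrite ea eb ec in p_blk.
    by apply/eqP/val_inj; apply: block_perm_fun_inj p_blk q_blk.
  have [w1 [a1 [b1 [c1 [blk1 le1 [aa1 cc1 gap1] [a1a' c1c' cb1 ba1]]]]]] :=
    bruhat_le_block_step ab' bc' q_blk aa cc cb ba gap.
  case: (ltnP 1 (a' - a + (c - c'))) => [gap2|]; last by split=> //; split; lia.
  case/negP: nob; apply/existsP.
  exists (Sub w1 (block_perm_bigrassmannian blk1)); rewrite /bigrass_lt /= le1.
  rewrite (block_bruhat_le p_blk blk1) // !andbT; apply/andP; split.
    apply/eqP => pE; rewrite pE /= in p_blk.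
    have [] := block_perm_inj p_blk blk1; lia.
  apply/eqP => qE; rewrite -qE /= in q_blk.
  have [] := block_perm_inj q_blk blk1; lia.
split.
  rewrite /bigrass_lt (block_bruhat_le p_blk q_blk) // andbT.
  apply/eqP => pq; rewrite pq in p_blk.
  have [] := block_perm_inj p_blk q_blk; lia.
apply/existsP => -[r /andP[/andP[pr le_pr] /andP[rq le_rq]]].
have [a1 [b1 [c1 r_blk]]] := bigrass_block r.
have [ab1 bc1 _ _] := r_blk.
have [? ? ? ?] := bruhat_le_block p_blk r_blk le_pr.
have [? ? ? ?] := bruhat_le_block r_blk q_blk le_rq.
case: (posnP (a1 - a + (c - c1))) => [gap0|gap1].
  have [ea eb ec] : [/\ a1 = a, b1 = b & c1 = c] by split; lia.
  rewrite ea eb ec in r_blk; case/eqP: rq.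
  by apply/val_inj/(block_perm_fun_inj r_blk q_blk).
have [ea eb ec] : [/\ a1 = a', b1 = b' & c1 = c'] by split; lia.
rewrite ea eb ec in r_blk; case/eqP: pr.
by apply/val_inj/(block_perm_fun_inj p_blk r_blk).
Qed.

(** * The distance between length vectors *)

Definition length_dist (p q : bigrass n) :=
  let: (l1, l2, l3, l4) := length_vector p in
  let: (m1, m2, m3, m4) := length_vector q in
  maxn (`|l1 - m1| + `|l4 - m4|) (`|l2 - m2| + `|l3 - m3|).

Lemma length_distE (p q : bigrass n) a b c a' b' c' :
  block_perm (val p) a b c -> block_perm (val q) a' b' c' ->
  length_dist p q =
    maxn (`|a - a'| + `|c - c'|) (`|(b - a)%N - (b' - a')%N| + `|(c - b)%N - (c' - b')%N|).
Proof.
move=> p_blk q_blk; have [_ _ ? _] := p_blk; have [_ _ ? _] := q_blk.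
by rewrite /length_dist (length_vectorE p_blk) (length_vectorE q_blk); lia.
Qed.

Lemma length_dist_hasse (p r q : bigrass n) :
  hasse p r -> length_dist p q <= (length_dist r q).+1.
Proof.
have [a [b [c p_blk]]] := bigrass_block p.
have [a1 [b1 [c1 r_blk]]] := bigrass_block r.
have [a' [b' [c' q_blk]]] := bigrass_block q.
rewrite (length_distE p_blk q_blk) (length_distE r_blk q_blk).
have [? ? ? _] := p_blk; have [? ? ? _] := q_blk; have [? ? ? _] := r_blk.
by case/orP => [/(bigrass_coversP r_blk p_blk)|/(bigrass_coversP p_blk r_blk)];
  move=> [[? ? ?] [? ?]]; lia.
Qed.

Lemma length_dist_eq0 (p q : bigrass n) : length_dist p q = 0 -> p = q.
Proof.
have [a [b [c p_blk]]] := bigrass_block p.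
have [a' [b' [c' q_blk]]] := bigrass_block q.
rewrite (length_distE p_blk q_blk) => d0.
have [? ? _ _] := p_blk; have [? ? _ _] := q_blk.
have [ea eb ec] : [/\ a' = a, b' = b & c' = c] by split; lia.
rewrite ea eb ec in q_blk.
by apply/val_inj/(block_perm_fun_inj p_blk q_blk).
Qed.

Lemma length_distxx (p : bigrass n) : length_dist p p = 0.
Proof.
by rewrite /length_dist; case: (length_vector p) => [[[? ?] ?] ?]; lia.
Qed.

Lemma length_dist_step (p q : bigrass n) : length_dist p q != 0 ->
  exists2 r, hasse p r & length_dist p q = (length_dist r q).+1.
Proof.
have [a [b [c p_blk]]] := bigrass_block p.
have [a' [b' [c' q_blk]]] := bigrass_block q.
rewrite (length_distE p_blk q_blk).
move dE: (maxn _ _) => d dN0.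
have [ab bc cn _] := p_blk; have [ab' bc' cn' _] := q_blk.
(* Any triple comparable with that of [p] and one outer unit away yields a neighbour, so only
   arithmetic remains. *)
have reach a1 b1 c1 : a1 < b1 -> b1 < c1 -> c1 <= n ->
    `|a - a1| + `|c - c1| = 1 ->
    [&& a <= a1, c1 <= c, c1 - b1 <= c - b & b1 - a1 <= b - a] ||
    [&& a1 <= a, c <= c1, c - b <= c1 - b1 & b - a <= b1 - a1] ->
    d = (maxn (`|a1 - a'| + `|c1 - c'|)
         (`|(b1 - a1)%N - (b' - a')%N| + `|(c1 - b1)%N - (c' - b')%N|)).+1 ->
    exists2 r, hasse p r & d = (length_dist r q).+1.
  move=> ab1 bc1 cn1 unit ord d1E; have [w1 blk1] := block_perm_exists ab1 bc1 cn1.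
  pose r : bigrass n := Sub w1 (block_perm_bigrassmannian blk1).
  have r_blk : block_perm (val r) a1 b1 c1 by [].
  exists r; last by rewrite (length_distE r_blk q_blk).
  clear dE dN0 d1E; apply/orP; case/orP: ord => /and4P[? ? ? ?]; [left|right].
    by apply/(bigrass_coversP r_blk p_blk); split; [split|]; lia.
  by apply/(bigrass_coversP p_blk r_blk); split; [split|]; lia.
(* Decrease both distances if they are nonzero; if one of them vanishes, the
   other is even, hence at least 2, and the vanishing one may become 1. *)
have [lt_a|lt_a|eq_a] := ltngtP a a'.
- case: (ltnP (b' - a') (b - a)) => lt_ba; first by apply: (reach a.+1 b c); lia.
  case: (ltnP (c' - b') (c - b)) => lt_cb; first by apply: (reach a.+1 b.+1 c); lia.
  (* Neither inner length is above its target while [l1] is below, so [l4] is above and gives a unit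
     to an inner length. *)
  case: (ltnP (c - b) (c' - b')) => lt_cb'; first by apply: (reach a b c.+1); lia.
  by apply: (reach a b.+1 c.+1); lia.
- case: (ltnP (c - b) (c' - b')) => lt_cb; first by apply: (reach a.-1 b.-1 c); lia.
  case: (ltnP (b - a) (b' - a')) => lt_ba; first by apply: (reach a.-1 b c); lia.
  case: (ltnP (b' - a') (b - a)) => lt_ba'; first by apply: (reach a b.-1 c.-1); lia.
  case: (ltnP (c' - b') (c - b)) => lt_cb'; first by apply: (reach a b c.-1); lia.
  by apply: (reach a.-1 b c); lia.
have [lt_c|lt_c|eq_c] := ltngtP c c'.
- case: (ltnP (c - b) (c' - b')) => lt_cb; first by apply: (reach a b c.+1); lia.
  by apply: (reach a b.+1 c.+1); lia.
- case: (ltnP (b' - a') (b - a)) => lt_ba; first by apply: (reach a b.-1 c.-1); lia.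
  by apply: (reach a b c.-1); lia.
(* The outer lengths agree, so one inner length exceeds its target and gives a unit to [l1]. *)
case: (ltnP b b') => lt_b; first by apply: (reach a.+1 b.+1 c); lia.
by apply: (reach a.+1 b c); lia.
Qed.

Lemma block_bigrass a b c : a < b -> b < c -> c <= n ->
  exists p : bigrass n, block_perm (val p) a b c.
Proof.
move=> ab bc cn; have [w blk] := block_perm_exists ab bc cn.
by exists (Sub w (block_perm_bigrassmannian blk)).
Qed.

End Extension.

(** * Graph distance from a potential *)

Lemma is_distance_of_steps (T : finType) (e : rel T) (d : T -> T -> nat) :
  (forall x, d x x = 0) -> (forall x y, d x y = 0 -> x = y) ->
  (forall x z y, e x z -> d x y <= (d z y).+1) ->
  (forall x y, d x y != 0 -> exists2 z, e x z & d x y = (d z y).+1) ->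
  forall x y, is_distance e x y (d x y).
Proof.
move=> dxx d0 d_edge d_step x y; split.
  (* Following edges along which [d] drops gives a walk of length [d x y]. *)
  have [m] := ubnP (d x y); elim: m x => // m IH x lt_m.
  case: (eqVneq (d x y) 0) => [dxy|/d_step[z xz dE]].
    by rewrite dxy (d0 _ _ dxy); exists [::].
  rewrite dE in lt_m *; have [s [zs sy <-]] := IH z lt_m.
  by exists (z :: s); rewrite /= xz.
move=> k [s [xs <- <-]]; elim: s x xs => [|z s IH] x /=; first by rewrite dxx.
by move=> /andP[xz zs]; apply: leq_trans (d_edge _ _ _ xz) _; apply: IH.
Qed.

Theorem theorem3p5 (n : nat) (hn : 2 <= n) :
  (forall (p s : bigrass n) (l1 l2 l3 l4 m1 m2 m3 m4 : nat),
      length_vector p = (l1, l2, l3, l4) ->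
      length_vector s = (m1, m2, m3, m4) ->
      is_distance (@hasse n) p s
        (maxn (`|l1 - m1| + `|l4 - m4|) (`|l2 - m2| + `|l3 - m3|)))
  /\ connected_graph (@hasse n).
Proof.
have dist (p s : bigrass n) : is_distance (@hasse n) p s (length_dist p s).
  apply: is_distance_of_steps.
  - exact: length_distxx.
  - exact: length_dist_eq0.
  - exact: length_dist_hasse.
  - exact: length_dist_step.
split.
  move=> p s l1 l2 l3 l4 m1 m2 m3 m4 pE sE.
  by have := dist p s; rewrite /length_dist pE sE.
split.
  (* The triple [(0, 1, 2)] is the exchange of the first two values. *)
  have [p _] := block_bigrass (ltnSn 0) (ltnSn 1) hn.
  by apply/card_gt0P; exists p.
move=> p s; have [[t [pt ts _]] _] := dist p s.
by apply/connectP; exists t.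
Qed.
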